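(* Let $\mathcal{C} \subseteq \mathcal{D}$, and let $f,g: K_0^{sp}(\mathcal{D}) \to K_0^{sp}(\mathcal{C})$ be $\mathcal{C}$-barcoding invariants. Then the map $$T:\ker f\to\ker g,\qquad x\mapsto x-g(x),$$ is an isomorphism (in particular it is well defined), it restricts to a bijection $\ker f\setminus\ker g\to\ker g\setminus\ker f$, and it fixes (every element of) the intersection $\ker f\cap\ker g$.
   Context: $\mathcal{D}$ denotes an essentially small Krull-Schmidt category, i.e. an additive category whose isomorphism classes of objects form a set and in which every object decomposes as a finite direct sum of objects with local endomorphism rings. The notation $\mathcal{C}\subseteq\mathcal{D}$ means that $\mathcal{C}$ is a full subcategory of $\mathcal{D}$ containing the zero object and closed under isomorphisms, (finite) direct sums and direct summands; then $\mathcal{C}$ is also Krull-Schmidt. $\mathrm{ind}(\mathcal{D})$ is the set of isomorphism classes of indecomposable objects of $\mathcal{D}$. The split Grothendieck group $K_0^{sp}(\mathcal{D})$ is the free abelian group generated by isomorphism classes $[M]$ of objects of $\mathcal{D}$ modulo the relations $[M_1\oplus M_2]=[M_1]+[M_2]$; it is free abelian with basis $\mathrm{ind}(\mathcal{D})$. If $\mathcal{C}\subseteq\mathcal{D}$, then $\mathrm{ind}(\mathcal{C})\subseteq\mathrm{ind}(\mathcal{D})$ and $K_0^{sp}(\mathcal{C})$ is regarded as the subgroup of $K_0^{sp}(\mathcal{D})$ generated by $\mathrm{ind}(\mathcal{C})$; the expression $x-g(x)$ is computed in $K_0^{sp}(\mathcal{D})$ via this inclusion. An additive invariant on $\mathcal{D}$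 is a group homomorphism $f: K_0^{sp}(\mathcal{D})\to G$ for some abelian group $G$. An additive invariant $f:K_0^{sp}(\mathcal{D})\to K_0^{sp}(\mathcal{C})$ is $\mathcal{C}$-barcoding if $f(c)=c$ for every $c\in K_0^{sp}(\mathcal{C})$. *)

(* Defs.v *)
From HB Require Import structures.
From mathcomp Require Import all_boot all_algebra.
From mathcomp Require Import generic_quotient ring_quotient.
From mathcomp Require Import boolp classical_sets functions.
From mathcomp Require Import freeg.

Set Implicit Arguments.
Unset Strict Implicit.
Unset Printing Implicit Defensive.

Import GRing.Theory.

Local Open Scope ring_scope.
Local Open Scope quotient_scope.

(* Essential smallness needs no field of its own: the objects form a [Type], so
   the isomorphism classes form a type on which a free abelian group exists. *)
Record preadditiveCat := PreadditiveCat {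
  obj :> Type;
  hom : obj -> obj -> zmodType;
  idm : forall X, hom X X;
  comp : forall X Y Z, hom Y Z -> hom X Y -> hom X Z;
  compA : forall X Y Z W (h : hom Z W) (g : hom Y Z) (f : hom X Y),
    comp h (comp g f) = comp (comp h g) f;
  comp1m : forall X Y (f : hom X Y), comp (idm Y) f = f;
  compm1 : forall X Y (f : hom X Y), comp f (idm X) = f;
  compDl : forall X Y Z (g1 g2 : hom Y Z) (f : hom X Y),
    comp (g1 + g2) f = comp g1 f + comp g2 f;
  compDr : forall X Y Z (g : hom Y Z) (f1 f2 : hom X Y),
    comp g (f1 + f2) = comp g f1 + comp g f2 }.

Arguments hom {p} X Y.
Arguments idm {p} X.
Arguments comp {p X Y Z} g f.

Notation "g \oc f" := (comp g f) (at level 40, left associativity).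

Section Preadditive.
Variable D : preadditiveCat.
Implicit Types X Y S : D.

Definition isomorphic X Y : Prop :=
  exists (f : hom X Y) (g : hom Y X), g \oc f = idm X /\ f \oc g = idm Y.

Definition zero_object X : Prop :=
  (forall Y (f : hom X Y), f = 0) /\ (forall Y (f : hom Y X), f = 0).

Definition direct_sum X Y S : Prop :=
  exists (i1 : hom X S) (i2 : hom Y S) (p1 : hom S X) (p2 : hom S Y),
    [/\ p1 \oc i1 = idm X, p2 \oc i2 = idm Y, p1 \oc i2 = 0, p2 \oc i1 = 0
      & i1 \oc p1 + i2 \oc p2 = idm S].

(* For n = 0 this says that S is a zero object. *)
Definition finite_direct_sum n (M : 'I_n -> D) S : Prop :=
  exists (i : forall k, hom (M k) S) (p : forall k, hom S (M k)),
    [/\ forall k, p k \oc i k = idm (M k),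
        forall k l, k != l -> p k \oc i l = 0
      & \sum_(k < n) i k \oc p k = idm S].

Lemma isomorphic_refl X : isomorphic X X.
Proof. by exists (idm X), (idm X); rewrite comp1m. Qed.

Lemma isomorphic_sym X Y : isomorphic X Y -> isomorphic Y X.
Proof. by move=> [f [g [gf fg]]]; exists g, f. Qed.

Lemma isomorphic_trans X Y Z :
  isomorphic X Y -> isomorphic Y Z -> isomorphic X Z.
Proof.
move=> [f [f' [f'f ff']]] [g [g' [g'g gg']]]; exists (g \oc f), (f' \oc g').
split; first by rewrite compA -(compA f') g'g compm1.
by rewrite compA -(compA g) ff' compm1.
Qed.

Definition End X : Type := hom X X.

HB.instance Definition _ X := GRing.Zmodule.on (End X).

Definition End_mul X (g f : End X) : End X := g \oc f.

Lemma End_mulA X : associative (@End_mul X).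
Proof. by move=> h g f; exact: compA. Qed.
Lemma End_1mul X : left_id (idm X : End X) (@End_mul X).
Proof. exact: comp1m. Qed.
Lemma End_mul1 X : right_id (idm X : End X) (@End_mul X).
Proof. exact: compm1. Qed.
Lemma End_mulDl X : left_distributive (@End_mul X) +%R.
Proof. by move=> g1 g2 f; exact: compDl. Qed.
Lemma End_mulDr X : right_distributive (@End_mul X) +%R.
Proof. by move=> g f1 f2; exact: compDr. Qed.

HB.instance Definition _ X := GRing.Zmodule_isPzRing.Build (End X)
  (@End_mulA X) (@End_1mul X) (@End_mul1 X) (@End_mulDl X) (@End_mulDr X).

End Preadditive.

Definition invertible (R : pzRingType) (x : R) : Prop :=
  exists y : R, y * x = 1 /\ x * y = 1.

Definition local_ring (R : pzRingType) : Prop :=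
  (1 : R) <> 0 /\
  forall x y : R, ~ invertible x -> ~ invertible y -> ~ invertible (x + y).

Record additiveCat := AdditiveCat {
  preadd :> preadditiveCat;
  has_zero_object : exists Z : preadd, zero_object Z;
  has_direct_sum : forall X Y : preadd, exists S, direct_sum X Y S }.

Definition krull_schmidt (D : additiveCat) : Prop :=
  forall X : D, exists (n : nat) (M : 'I_n -> D),
    (forall k, local_ring (End (M k))) /\ finite_direct_sum M X.

Record addSubcat (D : additiveCat) := AddSubcat {
  in_subcat :> D -> Prop;
  subcat_zero : forall Z, zero_object Z -> in_subcat Z;
  subcat_iso : forall X Y, isomorphic X Y -> in_subcat X -> in_subcat Y;
  subcat_sum : forall X Y S,
    direct_sum X Y S -> in_subcat X -> in_subcat Y -> in_subcat S;
  subcat_summand : forall X Y S, direct_sum X Y S -> in_subcat S -> in_subcat X }.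

Section FullSubcategory.
Variables (D : additiveCat) (C : addSubcat D).

Definition full_preadd : preadditiveCat :=
  @PreadditiveCat {X : D | C X} (fun X Y => hom (sval X) (sval Y))
    (fun X => idm (sval X)) (fun X Y Z g f => g \oc f)
    (fun X Y Z W => @compA D _ _ _ _) (fun X Y => @comp1m D _ _)
    (fun X Y => @compm1 D _ _) (fun X Y Z => @compDl D _ _ _)
    (fun X Y Z => @compDr D _ _ _).

Lemma full_has_zero : exists Z : full_preadd, zero_object Z.
Proof.
have [Z Z0] := has_zero_object D.
by exists (exist _ Z (subcat_zero C Z0)); split=> Y f; [exact: Z0.1 | exact: Z0.2].
Qed.

Lemma full_has_sum (X Y : full_preadd) : exists S, direct_sum X Y S.
Proof.
have [S XYS] := has_direct_sum (sval X) (sval Y).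
by exists (exist _ S (subcat_sum XYS (svalP X) (svalP Y))).
Qed.

Definition full_subcat : additiveCat := AdditiveCat full_has_zero full_has_sum.

End FullSubcategory.

Coercion full_subcat : addSubcat >-> additiveCat.

Section SplitGrothendieck.
Variable D : additiveCat.

Definition iso_rel (X Y : {classic D}) : bool := `[< @isomorphic D X Y >].

Lemma iso_rel_equiv : equiv_class_of iso_rel.
Proof.
split=> [X|X Y|Y X Z].
- exact/asboolP/isomorphic_refl.
- by apply/asboolP/asboolP; exact: isomorphic_sym.
- by move=> /asboolP XY /asboolP YZ; apply/asboolP; exact: isomorphic_trans YZ.
Qed.

Canonical iso_rel_equiv_rel := EquivRelPack iso_rel_equiv.

Definition iso_class := {eq_quot iso_rel}.

HB.instance Definition _ := Choice.on iso_class.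

Definition isocl (X : D) : iso_class := \pi_{eq_quot iso_rel} (X : {classic D}).

Lemma isoclP (X Y : D) : isocl X = isocl Y <-> isomorphic X Y.
Proof.
split=> [/eqP|XY]; first by rewrite /isocl eqmodE => /asboolP.
by apply/eqP; rewrite /isocl eqmodE; exact/asboolP.
Qed.

Lemma isocl_repr (c : iso_class) : isocl (repr c) = c.
Proof. exact: reprK. Qed.

Inductive sum_relations : {freeg iso_class} -> Prop :=
| sum_relations_gen X Y S of direct_sum X Y S :
    sum_relations (<< isocl S >> - (<< isocl X >> + << isocl Y >>))
| sum_relations0 : sum_relations 0
| sum_relationsB x y of sum_relations x & sum_relations y :
    sum_relations (x - y).

Definition sum_rel_pred : {pred {freeg iso_class}} :=
  fun x => `[< sum_relations x >].

Lemma sum_rel_zmod_closed : zmod_closed sum_rel_pred.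
Proof.
split; first exact/asboolP/sum_relations0.
by move=> x y /asboolP xR /asboolP yR; exact/asboolP/sum_relationsB.
Qed.

HB.instance Definition _ :=
  GRing.isZmodClosed.Build {freeg iso_class} sum_rel_pred sum_rel_zmod_closed.

Definition K0 : Type := Quotient.quot sum_rel_pred.

HB.instance Definition _ := GRing.Zmodule.on K0.

Definition K0_pi (x : {freeg iso_class}) : K0 :=
  \pi_(Quotient.quot sum_rel_pred) x.

Definition K0_class (X : D) : K0 := K0_pi << isocl X >>.

Lemma K0_piB : {morph K0_pi : x y / x - y}.
Proof. by move=> x y; rewrite /K0_pi pi_addr pi_oppr. Qed.

HB.instance Definition _ :=
  GRing.isZmodMorphism.Build {freeg iso_class} K0 K0_pi K0_piB.

Lemma K0_pi_eq x y : K0_pi x = K0_pi y <-> sum_relations (x - y).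
Proof.
split=> [xy|xy].
  have /eqP := xy.
  by rewrite /K0_pi -Quotient.idealrBE => /asboolP.
by apply/eqP; rewrite /K0_pi -Quotient.idealrBE; exact/asboolP.
Qed.

Lemma K0_class_sum (X Y S : D) :
  direct_sum X Y S -> K0_class S = K0_class X + K0_class Y.
Proof. by move=> XYS; rewrite /K0_class -raddfD; apply/K0_pi_eq; constructor. Qed.

End SplitGrothendieck.

Section Inclusion.
Variables (D : additiveCat) (C : addSubcat D).

Definition incl_free (x : {freeg (iso_class C)}) : {freeg (iso_class D)} :=
  fglift (fun c : iso_class C => << isocl (sval (repr c : C)) >>) x.

Lemma incl_freeB : {morph incl_free : x y / x - y}.
Proof. exact: lift_is_additive. Qed.

HB.instance Definition _ :=
  GRing.isZmodMorphism.Build {freeg (iso_class C)} {freeg (iso_class D)}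
    incl_free incl_freeB.

Lemma incl_free_isocl (X : C) :
  K0_pi (incl_free << isocl X >>) = K0_class (sval X).
Proof.
rewrite /incl_free liftU scale1r /K0_class; congr (K0_pi << _ >>).
have /isoclP [f [g [gf fg]]] := isocl_repr (isocl X).
by apply/isoclP; exists f, g.
Qed.

Lemma incl_free_sum_relations x :
  sum_relations x -> K0_pi (incl_free x) = 0.
Proof.
elim=> [X Y S [i1 [i2 [p1 [p2 XYS]]]]||{}x y _ x0 _ y0].
- rewrite incl_freeB K0_piB (raddfD incl_free) (raddfD (@K0_pi D)) /=.
  rewrite !incl_free_isocl.
  apply/eqP; rewrite subr_eq0; apply/eqP/K0_class_sum.
  by exists i1, i2, p1, p2.
- by rewrite !raddf0.
- by rewrite !raddfB /= x0 y0 subrr.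
Qed.

(* The map K0 C -> K0 D along which K0 C is regarded as a subgroup of K0 D;
   by [K0_incl_class] it sends the class of M in C to the class of M in D, and
   by [barcoding_incl_inj] it is injective as soon as a barcoding exists. *)
Definition K0_incl (x : K0 C) : K0 D := K0_pi (incl_free (repr x)).

Lemma K0_incl_pi x : K0_incl (K0_pi x) = K0_pi (incl_free x).
Proof.
apply/eqP; rewrite -subr_eq0 /K0_incl -!raddfB.
apply/eqP/incl_free_sum_relations/K0_pi_eq.
exact: reprK.
Qed.

Lemma K0_incl_class (X : C) : K0_incl (K0_class X) = K0_class (sval X).
Proof. by rewrite /K0_class K0_incl_pi incl_free_isocl. Qed.

Lemma K0_inclB : {morph K0_incl : x y / x - y}.
Proof.
move=> x y.
have piK (z : K0 C) : K0_pi (repr z) = z by exact: reprK.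
by rewrite -(piK x) -(piK y) -raddfB !K0_incl_pi !raddfB.
Qed.

HB.instance Definition _ :=
  GRing.isZmodMorphism.Build (K0 C) (K0 D) K0_incl K0_inclB.

End Inclusion.

Definition barcoding (D : additiveCat) (C : addSubcat D)
    (f : {additive K0 D -> K0 C}) : Prop :=
  forall c : K0 C, f (K0_incl c) = c.

Lemma barcoding_incl_inj (D : additiveCat) (C : addSubcat D)
  (f : {additive K0 D -> K0 C}) : barcoding f -> injective (@K0_incl D C).
Proof. exact: can_inj. Qed.

Section Kernel.
Variables (U V : zmodType) (f : {additive U -> V}).

Definition in_ker : {pred U} := fun x => f x == 0.

Lemma in_ker_zmod_closed : zmod_closed in_ker.
Proof.
split=> [|x y]; rewrite /in_mem /= /in_ker ?raddf0 ?raddfB //.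
by move=> /eqP-> /eqP->; rewrite subrr.
Qed.

HB.instance Definition _ := GRing.isZmodClosed.Build U in_ker in_ker_zmod_closed.

Record ker := Ker { ker_val : U; _ : ker_val \in in_ker }.

HB.instance Definition _ := [isSub for ker_val].
HB.instance Definition _ := [Choice of ker by <:].
HB.instance Definition _ := [SubChoice_isSubZmodule of ker by <:].

End Kernel.

(* Main.v *)
(** Writing [i] for the inclusion [K0 C -> K0 D], the composite [i \o g] is an
    idempotent endomorphism of [K0 D] with kernel [ker g], so [x - i (g x)] lies
    in [ker g]. If [f x = 0], then [f (x - i (g x)) = - g x]: hence
    [y |-> y - i (f y)] inverts the map, and the image of [x] lies in [ker f]
    exactly when [x] lies in [ker g]. *)
Require Import Defs.
From HB Require Import structures.
From mathcomp Require Import all_boot all_algebra.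
From mathcomp Require Import boolp classical_sets functions.

Import GRing.Theory.

Local Open Scope ring_scope.

Section KernelTransfer.
Variables (U V : zmodType) (i : {additive V -> U}).

Lemma in_kerE (f : {additive U -> V}) (x : U) : (x \in in_ker f) = (f x == 0).
Proof. by []. Qed.

Lemma ker_valP (f : {additive U -> V}) (x : ker f) : f (ker_val x) = 0.
Proof. exact/eqP/(valP x). Qed.

Section Transfer.
Variables (f g : {additive U -> V}) (iK : cancel i g).

Lemma sub_section_in_ker (x : U) : x - i (g x) \in in_ker g.
Proof. by rewrite in_kerE raddfB /= iK subrr. Qed.

(** Both maps are parameters, so that exchanging [f] and [g] gives the candidate inverse. *)
Definition ker_transfer (x : ker f) : ker g :=
  Ker (sub_section_in_ker (ker_val x)).

Lemma ker_transferB : {morph ker_transfer : x y / x - y}.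
Proof.
move=> x y; apply/val_inj; rewrite raddfB /= raddfB /= raddfB /= !opprB.
(* Both sides regroup as [x + i (g y)] plus the sum of [- y] and [- i (g x)]. *)
by rewrite addrACA [RHS]addrACA; congr (_ + _); rewrite addrC.
Qed.

HB.instance Definition _ :=
  GRing.isZmodMorphism.Build (ker f) (ker g) ker_transfer ker_transferB.

End Transfer.

Variables (f g : {additive U -> V}) (fiK : cancel i f) (giK : cancel i g).

(** Since [i] is also a section of [f] and [f] kills [x], only the correction term survives. *)
Lemma ker_transfer_val (x : ker f) :
  f (ker_val (ker_transfer f g giK x)) = - g (ker_val x).
Proof. by rewrite raddfB /= fiK ker_valP sub0r. Qed.

Lemma ker_transfer_in_ker (x : ker f) :
  (ker_val (ker_transfer f g giK x) \in in_ker f) = (ker_val x \in in_ker g).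
Proof. by rewrite !in_kerE ker_transfer_val oppr_eq0. Qed.

(** The way back subtracts [i (- g x)], which restores the removed [i (g x)]. *)
Lemma ker_transferK :
  cancel (ker_transfer f g giK) (ker_transfer g f fiK).
Proof.
move=> x; apply/val_inj => /=.
by rewrite ker_transfer_val raddfN opprK subrK.
Qed.

End KernelTransfer.

Theorem theorem3p14 (D : additiveCat) (D_ks : krull_schmidt D)
    (C : addSubcat D) (f g : {additive K0 D -> K0 C})
    (f_bar : barcoding f) (g_bar : barcoding g) :
  exists T : {additive ker f -> ker g},
    [/\ forall x : ker f, ker_val (T x) = ker_val x - K0_incl (g (ker_val x)),
        bijective T,
        set_bij [set x : ker f | ker_val x \notin in_ker g]%classic
                [set y : ker g | ker_val y \notin in_ker f]%classic T
      & forall x : ker f, ker_val x \in in_ker g -> ker_val (T x) = ker_val x].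
Proof.
have fK : cancel (K0_incl (C := C)) f by exact: f_bar.
have gK : cancel (K0_incl (C := C)) g by exact: g_bar.
pose T : {additive ker f -> ker g} := ker_transfer _ _ _ f g gK.
have TK := ker_transferK _ _ _ f g fK gK.
(* The symmetry between [f] and [g] makes the inverse two-sided. *)
have TK' := ker_transferK _ _ _ g f gK fK.
have T_in_ker x : (ker_val (T x) \in in_ker f) = (ker_val x \in in_ker g).
  exact: ker_transfer_in_ker.
exists T; split=> [//||| x].
- exact: Bijective TK TK'.
- split=> [x /= | x y _ _ | y /= yNf].
  + by rewrite T_in_ker.
  + exact: can_inj TK x y.
  (* The reverse transfer of [y] lies outside [ker g] because [y] lies outside [ker f]: the
     membership equivalence with [f] and [g] exchanged. *)
  + exists (ker_transfer _ _ _ g f fK y); last exact: TK'.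
    by rewrite /= ker_transfer_in_ker.
(* On the intersection the subtracted term is [K0_incl 0], hence zero. *)
- by rewrite in_kerE => /eqP gx0; rewrite /= gx0 raddf0 subr0.
Qed.
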